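(* The following two statements are equivalent: (a) (Oriented Alon–Saks–Seymour conjecture) there exists a polynomial $P$ such that every graph $G$ satisfies $\chi(G)\le P(\mathbf{bp}_{or}(G))$; (b) (Clique–Stable Set separation conjecture) there exists a polynomial $Q$ such that every graph on $n$ vertices has a CS-separator of size at most $Q(n)$.
   Context: $\chi(G)$ is the chromatic number. The oriented bipartite packing $\mathbf{bp}_{or}(G)$ of an undirected graph $G$ is the minimum $k$ such that there exist pairs $(A_1,B_1),\dots,(A_k,B_k)$ of disjoint vertex subsets with every vertex of $A_i$ adjacent to every vertex of $B_i$, such that every edge $xy$ satisfies $x\in A_i,y\in B_i$ or $y\in A_i,x\in B_i$ for some $i$, and there is no ordered pair $(x,y)$ and distinct $i\neq j$ with $x\in A_i\cap A_j$ and $y\in B_i\cap B_j$. A cut of $G=(V,E)$ is a pair $(A,B)$ with $A\cup B=V$, $A\cap B=\emptyset$; it separates a clique $K$ and a stable set $S$ if $K\subseteq A$, $S\subseteq B$. A CS-separator is a family of cuts separating every clique $K$ from every stable set $S$ with $K\cap S=\emptyset$. *)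

(* Defs.v *)
From mathcomp Require Import all_boot all_order all_algebra.

Set Implicit Arguments.
Unset Strict Implicit.
Unset Printing Implicit Defensive.

Record sgraph := SGraph {
  vertex :> finType;
  adj : rel vertex;
  adj_sym : symmetric adj;
  adj_irr : irreflexive adj }.

Section Graph.
Variable G : sgraph.
Implicit Types (x y : G) (A B K S : {set G}) (C : {set G} * {set G}).

Definition clique K : bool :=
  [forall x in K, forall y in K, (x != y) ==> adj x y].

Definition stable S : bool :=
  [forall x in S, forall y in S, ~~ adj x y].

Definition proper_coloring k (c : {ffun G -> 'I_k}) : bool :=
  [forall x, forall y, adj x y ==> (c x != c y)].

Definition colorable k : bool := [exists c : {ffun G -> 'I_k}, proper_coloring c].

Lemma ex_colorable : exists k, colorable k.
Proof.
exists #|G|; apply/existsP; exists [ffun x => enum_rank x].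
apply/forallP=> x; apply/forallP=> y; apply/implyP=> xy.
rewrite !ffunE; apply: contraTneq xy => /enum_rank_inj ->.
by rewrite adj_irr.
Qed.

Definition chi : nat := ex_minn ex_colorable.

(* (p i).1 and (p i).2 are the i-th sets A_i and B_i; they may be empty. *)
Definition oriented_packing k (p : {ffun 'I_k -> {set G} * {set G}}) : bool :=
  [&& [forall i, [disjoint (p i).1 & (p i).2]],
      [forall i, forall x in (p i).1, forall y in (p i).2, adj x y],
      [forall x, forall y, adj x y ==>
        [exists i, (x \in (p i).1) && (y \in (p i).2)
                || (y \in (p i).1) && (x \in (p i).2)]]
    & [forall x, forall y, forall i, forall j, (i != j) ==>
        ~~ ((x \in (p i).1 :&: (p j).1) && (y \in (p i).2 :&: (p j).2))]].

Definition has_oriented_packing k : bool :=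
  [exists p : {ffun 'I_k -> {set G} * {set G}}, oriented_packing p].

(* One pair ({x}, {y}) for each ordered pair (x, y) of adjacent vertices. *)
Lemma ex_oriented_packing : exists k, has_oriented_packing k.
Proof.
pose E := [set u : G * G | adj u.1 u.2].
exists #|E|; apply/existsP.
exists [ffun i => let u := @enum_val _ (mem E) i in ([set u.1], [set u.2])].
apply/and4P; split.
- apply/forallP=> i; rewrite ffunE /= disjoints1 inE.
  have := enum_valP i; rewrite inE.
  by apply: contraTneq => ->; rewrite adj_irr.
- apply/forallP=> i; apply/forall_inP=> x; rewrite ffunE inE => /eqP->.
  apply/forall_inP=> y; rewrite inE => /eqP->.
  by have := enum_valP i; rewrite inE.
- apply/forallP=> x; apply/forallP=> y; apply/implyP=> xy.
  have Exy : (x, y) \in E by rewrite inE.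
  apply/existsP; exists (enum_rank_in Exy (x, y)).
  by rewrite ffunE /= enum_rankK_in //= !inE !eqxx.
- apply/forallP=> x; apply/forallP=> y; apply/forallP=> i; apply/forallP=> j.
  apply/implyP; apply: contraNN; rewrite !ffunE /= !inE.
  case/andP=> /andP[/eqP xi /eqP xj] /andP[/eqP yi /eqP yj].
  apply/eqP/enum_val_inj.
  by rewrite [LHS]surjective_pairing [RHS]surjective_pairing -xi -xj -yi -yj.
Qed.

Definition bp_or : nat := ex_minn ex_oriented_packing.

Definition is_cut C : bool := (C.1 :|: C.2 == setT) && (C.1 :&: C.2 == set0).

Definition separates C K S : bool := (K \subset C.1) && (S \subset C.2).

Definition cs_separator (F : {set {set G} * {set G}}) : Prop :=
  (forall C, C \in F -> is_cut C) /\
  (forall K S, clique K -> stable S -> K :&: S = set0 ->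
     exists2 C, C \in F & separates C K S).

End Graph.

(* Main.v *)
(** Both directions encode a vertex by a disjoint pair (clique, stable set).

    (a) => (b): join two such pairs (K, S) and (K', S') of G whenever K meets S'
    or K' meets S.  The vertices x of G give an oriented packing with
    A_x = {(K, S) | x in K} and B_x = {(K, S) | x in S}, since a clique meets a
    stable set at most once.  In a colour class the union of the cliques misses
    every stable set, so each colour yields a cut.

    (b) => (a): given an oriented packing (A_i, B_i), join the indices i and j
    when A_i meets A_j.  Each vertex v gives the clique {i | v in A_i} and the
    set {i | v in B_i}, which is stable because no ordered pair is covered
    twice.  Colouring v by a cut separating the two is proper: if v in A_i and
    w in B_i, then i would lie on both sides of a common cut. *)
Require Import Defs.
From mathcomp Require Import all_boot all_order all_algebra.
From mathcomp Require Import reals.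
Import Order.TTheory GRing.Theory Num.Theory.

Set Implicit Arguments.
Unset Strict Implicit.
Unset Printing Implicit Defensive.

Local Open Scope ring_scope.

Lemma chi_le (G : sgraph) (k : nat) : colorable G k -> (chi G <= k)%N.
Proof. by rewrite /chi; case: ex_minnP => m _; apply. Qed.

Lemma chi_colorable (G : sgraph) : colorable G (chi G).
Proof. by rewrite /chi; case: ex_minnP. Qed.

Lemma bp_or_le (G : sgraph) (k : nat) :
  has_oriented_packing G k -> (bp_or G <= k)%N.
Proof. by rewrite /bp_or; case: ex_minnP => m _; apply. Qed.

Lemma bp_or_packing (G : sgraph) : has_oriented_packing G (bp_or G).
Proof. by rewrite /bp_or; case: ex_minnP. Qed.

Lemma cliqueP (G : sgraph) (K : {set G}) :
  reflect {in K &, forall x y, x != y -> adj x y} (clique K).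
Proof.
apply: (iffP forall_inP) => [h x y xK yK|h x xK].
  by move/forall_inP: (h x xK) => /(_ y yK)/implyP.
by apply/forall_inP => y yK; apply/implyP; apply: h.
Qed.

Lemma stableP (G : sgraph) (S : {set G}) :
  reflect {in S &, forall x y, ~~ adj x y} (stable S).
Proof.
apply: (iffP forall_inP) => [h x y xS yS|h x xS].
  by move/forall_inP: (h x xS) => /(_ y yS).
by apply/forall_inP => y yS; apply: h.
Qed.

Lemma clique_stable_meet (G : sgraph) (K S : {set G}) :
  clique K -> stable S -> {in K :&: S &, forall x y, x = y}.
Proof.
move=> /cliqueP cK /stableP sS x y /setIP[xK xS] /setIP[yK yS].
by apply/eqP; apply: contraNT (sS x y xS yS); apply: cK.
Qed.

Section PairGraph.
Variable G : sgraph.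
Implicit Types u v : {set G} * {set G}.

(** Disjointness makes [pair_arc] irreflexive and keeps the two sides of each packing pair apart. *)
Definition cs_pair u : bool :=
  [&& clique u.1, stable u.2 & [disjoint u.1 & u.2]].

Definition pair_arc u v : bool :=
  [&& cs_pair u, cs_pair v & ~~ [disjoint u.1 & v.2]].

Definition pair_adj u v : bool := pair_arc u v || pair_arc v u.

Lemma pair_adj_sym : symmetric pair_adj.
Proof. by move=> u v; rewrite /pair_adj orbC. Qed.

Lemma pair_adj_irr : irreflexive pair_adj.
Proof.
move=> u; rewrite /pair_adj orbb /pair_arc.
by apply/negbTE; apply/and3P => -[/and3P[_ _ ->]].
Qed.

Definition pair_graph : sgraph := SGraph pair_adj_sym pair_adj_irr.

Definition pair_packing : {ffun 'I_#|G| -> {set pair_graph} * {set pair_graph}} :=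
  [ffun i => ([set u | cs_pair u & enum_val i \in u.1],
              [set u | cs_pair u & enum_val i \in u.2])].

(** A vertex of [G] common to [u.1] and [v.2] is the same thing as a packing index, so completeness
    of each pair and coverage of the edges follow together. *)
Lemma pair_arcP u v :
  reflect (exists i, (u \in (pair_packing i).1) && (v \in (pair_packing i).2))
          (pair_arc u v).
Proof.
apply: (iffP idP) => [/and3P[csu csv /pred0Pn[x /andP[xu xv]]]|[i]].
  exists (enum_rank x); rewrite ffunE !inE enum_rankK csu csv.
  by apply/andP.
rewrite ffunE !inE => /andP[/andP[csu iu] /andP[csv iv]].
rewrite /pair_arc csu csv; apply/pred0Pn; exists (enum_val i).
by rewrite /= iu iv.
Qed.

Lemma pair_graph_packing : oriented_packing pair_packing.
Proof.
apply/and4P; split.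
- apply/forallP => i; apply/pred0Pn => -[u]; rewrite ffunE /= !inE.
  move=> /andP[/andP[/and3P[_ _ /pred0P/(_ (enum_val i)) /= h] iu] /andP[_ iv]].
  by move: h; rewrite iu iv.
- apply/forallP => i; apply/forall_inP => u iu; apply/forall_inP => v iv.
  by apply/orP; left; apply/pair_arcP; exists i; rewrite iu.
- apply/forallP => u; apply/forallP => v; apply/implyP => uv.
  by apply/existsP; case/orP: uv => /pair_arcP[i iuv]; exists i; rewrite iuv ?orbT.
- apply/forallP => u; apply/forallP => v; apply/forallP => i; apply/forallP => j.
  apply/implyP; apply: contraNN; rewrite !ffunE !inE.
  move=> /andP[/andP[/andP[/and3P[cK _ _] iu] /andP[_ ju]]].
  move=> /andP[/andP[/and3P[_ sS _] iv] /andP[_ jv]].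
  (* Both [enum_val i] and [enum_val j] lie in the clique [u.1] and in the stable set [v.2], so they
     coincide. *)
  apply/eqP/enum_val_inj.
  by apply: (clique_stable_meet cK sS); rewrite inE ?iu ?ju.
Qed.

Lemma bp_or_pair_graph : (bp_or pair_graph <= #|G|)%N.
Proof.
by apply: bp_or_le; apply/existsP; exists pair_packing; apply: pair_graph_packing.
Qed.

Lemma cs_separator_of_coloring k : colorable pair_graph k ->
  exists2 F : {set {set G} * {set G}}, cs_separator F & (#|F| <= k)%N.
Proof.
case/existsP => c /forallP c_proper.
pose U i := \bigcup_(u : {set G} * {set G} | cs_pair u && (c u == i)) u.1.
exists [set (U i, ~: U i) | i : 'I_k]; last first.
  by rewrite -[leqRHS]card_ord leq_imset_card.
split=> [C /imsetP[i _ ->]|K S cK sS KS0].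
  by rewrite /is_cut /= setUCr setICr !eqxx.
have csKS : cs_pair (K, S) by rewrite /cs_pair cK sS -setI_eq0 KS0 eqxx.
exists (U (c (K, S)), ~: U (c (K, S))); first exact: imset_f.
apply/andP; split=> /=.
  by apply: (bigcup_sup (K, S)); rewrite csKS eqxx.
rewrite -disjoints_subset.
apply/bigcup_disjointP => u /andP[csu /eqP cu].
(* If [u.1] met [S], there would be an arc from [u] to [(K, S)], two vertices of the same colour. *)
have /forallP/(_ (K, S))/implyP := c_proper u.
rewrite cu eqxx => h; rewrite disjoint_sym.
by apply: contraT => uS; apply: h; apply/orP; left; rewrite /pair_arc csu csKS.
Qed.

End PairGraph.

Section IndexGraph.
Variables (G : sgraph) (k : nat) (p : {ffun 'I_k -> {set G} * {set G}}).
Hypothesis p_packing : oriented_packing p.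

Definition index_adj (i j : 'I_k) : bool :=
  (i != j) && ~~ [disjoint (p i).1 & (p j).1].

Lemma index_adj_sym : symmetric index_adj.
Proof. by move=> i j; rewrite /index_adj eq_sym disjoint_sym. Qed.

Lemma index_adj_irr : irreflexive index_adj.
Proof. by move=> i; rewrite /index_adj eqxx. Qed.

Definition index_graph : sgraph := SGraph index_adj_sym index_adj_irr.

Definition left_indices (x : G) : {set index_graph} := [set i | x \in (p i).1].
Definition right_indices (x : G) : {set index_graph} := [set i | x \in (p i).2].

Lemma clique_left_indices x : clique (left_indices x).
Proof.
apply/cliqueP => i j; rewrite !inE => ix jx ij; apply/andP; split=> //.
by apply/pred0Pn; exists x; rewrite /= ix jx.
Qed.

Lemma stable_right_indices x : stable (right_indices x).
Proof.
have /and4P[_ _ _ /forallP once] := p_packing.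
apply/stableP => i j; rewrite !inE => ix jx.
apply/andP => -[ij /pred0Pn[y /andP[/= iy jy]]].
(* Here [y] lies in both left sides and [x] in both right sides, so the ordered pair [(y, x)] would
   be covered by [i] and by [j]. *)
have /forallP/(_ x)/forallP/(_ i)/forallP/(_ j)/implyP/(_ ij) := once y.
by rewrite !inE iy jy ix jx.
Qed.

Lemma disjoint_indices x : left_indices x :&: right_indices x = set0.
Proof.
have /and4P[/forallP disj _ _ _] := p_packing.
apply/setP => i; rewrite !inE.
by have /pred0P/(_ x) := disj i.
Qed.

Lemma colorable_of_cs_separator (F : {set {set index_graph} * {set index_graph}}) :
  cs_separator F -> colorable G #|F|.
Proof.
case=> F_cut F_sep.
have [_ _ /forallP cover _] := and4P p_packing.
have sep x : exists i : 'I_#|F|,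
    separates (enum_val i) (left_indices x) (right_indices x).
  have [C CF sepC] := F_sep _ _ (clique_left_indices x) (stable_right_indices x)
    (disjoint_indices x).
  by exists (enum_rank_in CF C); rewrite enum_rankK_in.
pose c := [ffun x => xchoose (sep x)].
(* The equality of colours is symmetric in [x] and [y], so this one claim handles both orientations
   of an edge. *)
have c_sep x y i : c x = c y -> x \in (p i).1 -> y \notin (p i).2.
  rewrite !ffunE => cxy ix; apply/negP => iy.
  have /andP[/subsetP/(_ i) xC _] := xchooseP (sep x).
  have /andP[_ /subsetP/(_ i) yC] := xchooseP (sep y).
  have /andP[_ /eqP/setP/(_ i)] := F_cut _ (enum_valP (xchoose (sep x))).
  by rewrite !inE xC ?inE // cxy yC ?inE.
apply/existsP; exists c; apply/forallP => x; apply/forallP => y; apply/implyP => xy.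
have /forallP/(_ y)/implyP/(_ xy)/existsP[i] := cover x.
by case/orP => /andP[i1]; apply: contraTneq => cxy; apply: (c_sep _ _ _ _ i1).
Qed.

End IndexGraph.

(** A bounding polynomial need not be monotone, and [bp_or (pair_graph G)] is only known to be at
    most [#|G|]. Taking absolute values of the coefficients gives an upper bound that increases on
    nonnegative arguments. *)
Lemma horner_le_norm (R : realDomainType) (P : {poly R}) (x y : R) :
  0 <= x -> x <= y -> P.[x] <= (\poly_(i < size P) `|P`_i|).[y].
Proof.
move=> x0 xy; rewrite horner_coef horner_poly; apply: ler_sum => i _.
apply: le_trans (ler_wpM2r _ (ler_norm _)) _; first exact: exprn_ge0.
by apply: ler_wpM2l => //; apply: lerXn2r; rewrite ?nnegrE // (le_trans x0).
Qed.

Theorem theorem18 (R : realType) :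
  (exists P : {poly R}, forall G : sgraph,
     (chi G)%:R <= P.[(bp_or G)%:R])
  <->
  (exists Q : {poly R}, forall (n : nat) (G : sgraph), #|G| = n ->
     exists2 F : {set {set G} * {set G}},
       cs_separator F & #|F|%:R <= Q.[n%:R]).
Proof.
split=> [[P chiP]|[Q sepQ]].
  exists (\poly_(i < size P) `|P`_i|) => n G <-.
  have [F sepF leF] := cs_separator_of_coloring (chi_colorable (pair_graph G)).
  have H_le : (bp_or (pair_graph G))%:R <= #|G|%:R :> R.
    by rewrite ler_nat; apply: bp_or_pair_graph.
  exists F => //; apply: le_trans (horner_le_norm P (ler0n _ _) H_le).
  by apply: le_trans (chiP _); rewrite ler_nat.
(* The index graph of an optimal packing has exactly [bp_or G] vertices, so [Q] itself serves. *)
exists Q => G; have /existsP[p p_packing] := bp_or_packing G.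
have [F sepF leF] := sepQ _ (index_graph p) (card_ord _).
apply: le_trans leF; rewrite ler_nat; apply: chi_le.
exact: colorable_of_cs_separator sepF.
Qed.
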